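(* For every real number $c\ge 1$ there exist a weight $w\in A_2^d$ on $[0,1)$ with $[w]_{A_2}\ge c$ and a function $f\in L^2(w)$ such that $$\|S(f)\|_{L^{2,\infty}(w)}>\frac{e^{-2}}{48}\Big([w]_{A_2}\log\big(1+[w]_{A_2}\big)\Big)^{1/2}\|f\|_{L^2(w)}.$$ Here $S$ is the dyadic square function on $[0,1)$ and $[w]_{A_2}$ is the dyadic $A_2$ characteristic of $w$.
   Context: For $n\ge 0$ let $\mathcal D_n$ be the collection of the $2^n$ dyadic intervals $[j2^{-n},(j+1)2^{-n})$, $0\le j<2^n$, of $[0,1)$; the dyadic subintervals of $[0,1)$ are the elements of $\bigcup_{n\ge0}\mathcal D_n$. For an integrable $f$ on $[0,1)$ put $f_n=\sum_{I\in\mathcal D_n}\chi_I\frac1{|I|}\int_I f$, $n\ge 0$, and define the dyadic square function $S(f)(x)=\big(|f_0(x)|^2+\sum_{n\ge0}|f_{n+1}(x)-f_n(x)|^2\big)^{1/2}$. A weight $w$ is a positive integrable function on $[0,1)$, identified with the measure $w(E)=\int_E w(x)\,dx$. The dyadic $A_2$ characteristic is $[w]_{A_2}=\sup_Q\big(\frac1{|Q|}\int_Q w\big)\big(\frac1{|Q|}\int_Q w^{-1}\big)$, the supremum being taken over all dyadic subintervals $Q$ of $[0,1)$; $w\in A_2^d$ means that this is finite. Norms: $\|f\|_{L^2(w)}=\big(\int_{[0,1)}|f|^2w\big)^{1/2}$ and $\|g\|_{L^{2,\infty}(w)}=\sup_{\lambda>0}\lambda\, w(\{x\in[0,1):|g(x)|\ge\lambda\})^{1/2}$.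 The symbol $\log$ denotes the natural logarithm. *)

(* Defs.v *)
From HB Require Import structures.
From mathcomp Require Import all_boot all_order all_algebra.
From mathcomp Require Import all_classical all_reals all_analysis.
Set Implicit Arguments.
Unset Strict Implicit.
Unset Printing Implicit Defensive.
Import Order.TTheory GRing.Theory Num.Theory.
Import numFieldNormedType.Exports.

Local Open Scope classical_set_scope.
Local Open Scope ring_scope.

(* Functions on [0,1) are represented by total functions on R, of
   which only the values on [unit_itv] matter. *)
Definition unit_itv {R : realType} : set R := `[0, 1[.

(* [dyadic_itv R n j] is the interval [j 2^-n, (j+1) 2^-n), for any j. *)
Definition dyadic_subitv {R : realType} : set (set R) :=
  [set Q | exists n j : nat, (j < 2 ^ n)%N /\ Q = [set` dyadic_itv R n j]].

Definition avg {R : realType} (f : R -> R) (Q : set R) : R :=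
  (fine (lebesgue_measure Q))^-1 * \int[lebesgue_measure]_(x in Q) f x.

Definition dyadic_avg {R : realType} (f : R -> R) (n : nat) (x : R) : R :=
  \sum_(j < 2 ^ n)
    \1_([set` dyadic_itv R n j]) x * avg f [set` dyadic_itv R n j].

(* Extended-real valued, since the series may diverge at some points. *)
Definition square_fun {R : realType} (f : R -> R) (x : R) : \bar R :=
  sqrte ((`|dyadic_avg f 0 x| ^+ 2)%:E +
    \sum_(0 <= n <oo) (`|dyadic_avg f n.+1 x - dyadic_avg f n x| ^+ 2)%:E)%E.

Definition is_weight {R : realType} (w : R -> R) : Prop :=
  (forall x, unit_itv x -> 0 < w x) /\
  (@lebesgue_measure R).-integrable unit_itv (EFin \o w).

Definition weight_measure {R : realType} (w : R -> R) (E : set R) : \bar R :=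
  (\int[lebesgue_measure]_(x in E) (w x)%:E)%E.

(* The average of a nonnegative function, possibly +oo (w^-1 need not be
   integrable a priori). *)
Definition eavg {R : realType} (w : R -> R) (Q : set R) : \bar R :=
  (((fine (lebesgue_measure Q))^-1)%:E *
   \int[lebesgue_measure]_(x in Q) (w x)%:E)%E.

Definition A2char {R : realType} (w : R -> R) : \bar R :=
  ereal_sup [set (eavg w Q * eavg (fun x => (w x)^-1)%R Q)%E
            | Q in dyadic_subitv].

Definition in_A2d {R : realType} (w : R -> R) : Prop :=
  is_weight w /\ (A2char w < +oo)%E.

Definition L2norm {R : realType} (w f : R -> R) : \bar R :=
  sqrte (\int[lebesgue_measure]_(x in unit_itv) (`|f x| ^+ 2 * w x)%:E)%E.

Definition in_L2 {R : realType} (w f : R -> R) : Prop :=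
  measurable_fun (unit_itv : set R) f /\ (L2norm w f < +oo)%E.

Definition weakL2norm {R : realType} (w : R -> R) (g : R -> \bar R) : \bar R :=
  ereal_sup [set (l%:E *
      sqrte (weight_measure w [set x | unit_itv x /\ l%:E <= `|g x|]))%E
    | l in [set l : R | 0 < l]].

(* Main.v *)
Require Import Defs.
From HB Require Import structures.
From mathcomp Require Import all_boot all_order all_algebra.
From mathcomp Require Import all_classical all_reals all_analysis.
From mathcomp Require Import measurable_realfun ring lra.
Import Order.TTheory GRing.Theory Num.Theory.
Import numFieldNormedType.Exports.
Set Implicit Arguments.
Unset Strict Implicit.
Unset Printing Implicit Defensive.
Local Open Scope classical_set_scope.
Local Open Scope ring_scope.

(** The weight and the function realize many independent rounds of the
    St. Petersburg game, played by a random point under the probability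
    proportional to [w].  Let [Q] be the A_2 characteristic of [w].

    One round takes place along nested dyadic intervals [J_0], [J_1], ..., each
    the right half of the previous one.  From [J_i] to [J_(i+1)] the averages
    of [f] and of [w^-1] roughly double and the average of [w] is halved; so the
    product of the averages of [w] and [w^-1] stays comparable with [Q], and
    [J_(i+1)] carries one quarter of the mass of [w] in [J_i].  A point that
    leaves the round at the step [i], which has probability about [4^-i], has
    met a jump of [f] of size about [2^i], and its [S(f)^2] has grown by about
    [4^i].  Every [i <= k] thus contributes the same amount to the expected
    gain, which is of order [k].  The contribution of one round to the square
    of the norm of [f] in [L^2(w)] is only of order [1/Q]: at the end of the
    round [f] is large on a last small interval, where [w] is tiny.

    A point that leaves a round enters a new one.  Before that, almost all the
    mass of [w] in its interval is moved to a subinterval of relative size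
    [2^-k] (lemma [profile_dilute]).  Only this makes a new round possible,
    since the average of [w^-1] has to be small on the intervals outside the
    [J_i] but large at the beginning of a round.

    With [4^k] rounds the truncated gains obey a law of large numbers: [S(f)^2]
    exceeds a multiple of [k 4^k] on half of the mass of [w], whereas the square
    of the norm of [f] is of order [4^k/Q].  The square of the ratio of the two
    norms is thus of order [k Q], and the parameters are chosen such that [Q] is
    of order [64^k], so that [k] is comparable with [log Q].

    The law of large numbers is replaced by an exponential Markov inequality
    ([sqmean_tail]): the Laplace transform of [S(f)^2] under [w] is multiplied
    by about [1 - 3/8 k 4^-k] in each round ([doubling_bounds] and
    [game_profile]), so [4^k] rounds make it small as a power of [e^-k]
    ([game_sqmean_ge]).

    The number of rounds is finite, so [w] and [f] are step functions encoded by
    a finite binary tree, and all averages are computed by recursion on the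
    tree; [integral_stepfun_node] relates them to Lebesgue integrals. *)

(** * Dyadic trees *)

(** A finite dyadic tree encodes a pair of step functions on a dyadic interval:
    a leaf carries the constant values of [w] and [f] on its cell, and the two
    subtrees of a node describe the left and the right half. *)
Inductive dtree (R : Type) : Type :=
| Leaf of R & R
| Node of dtree R & dtree R.

Section Trees.
Context {R : realType}.
Implicit Types (T l r : dtree R) (h : R -> R -> R) (d t : R).

Fixpoint tmean h T : R :=
  match T with
  | Leaf a b => h a b
  | Node l r => (tmean h l + tmean h r) / 2
  end.

Definition wmean := tmean (fun a _ => a).
Definition smean := tmean (fun a _ => a^-1).
Definition fmean := tmean (fun _ b => b).
Definition energy := tmean (fun a b => b ^+ 2 * a).

(** Both halves of a cell see the same squared martingale difference, because
    the two differences are opposite. *)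
Definition jump l r : R := (fmean l - fmean r) / 2.

(** Nonnegativity of [f] is there to let every integral of a tree function be
    an integral of a nonnegative function. *)
Fixpoint admissible T : Prop :=
  match T with
  | Leaf a b => 0 < a /\ 0 <= b
  | Node l r => admissible l /\ admissible r
  end.

Fixpoint A2_le (A : R) T : Prop :=
  wmean T * smean T <= A /\
  match T with
  | Leaf _ _ => True
  | Node l r => A2_le A l /\ A2_le A r
  end.

(** The argument [s] accumulates the squared jumps met on the way down, so that
    at a leaf, when started from [0], it is the square of the square function
    without the [f_0] term. *)
Fixpoint sqmean (G : R -> R -> R -> R) (s : R) T : R :=
  match T with
  | Leaf a b => G a b s
  | Node l r => (sqmean G (s + jump l r ^+ 2) l + sqmean G (s + jump l r ^+ 2) r) / 2
  end.

(** The average of [exp (- t S^2) w], where [S] is the square function without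
    the [f_0] term: its Laplace transform under the measure [w]. *)
Fixpoint laplace (t : R) T : R :=
  match T with
  | Leaf a _ => a
  | Node l r => expR (- (t * jump l r ^+ 2)) * ((laplace t l + laplace t r) / 2)
  end.

Lemma sqmean_cst h s T : sqmean (fun a b _ => h a b) s T = tmean h T.
Proof. by elim: T s => //= l IHl r IHr s; rewrite IHl IHr. Qed.

Lemma wmean_gt0 T : admissible T -> 0 < wmean T.
Proof.
elim: T => [a b []//|l IHl r IHr /= [/IHl hl /IHr hr]].
by rewrite divr_gt0 ?addr_gt0.
Qed.

Lemma smean_gt0 T : admissible T -> 0 < smean T.
Proof.
elim: T => [a b [a0 _]|l IHl r IHr] /=; first by rewrite invr_gt0.
by move=> [/IHl hl /IHr hr]; rewrite divr_gt0 ?addr_gt0.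
Qed.

Lemma energy_ge0 T : admissible T -> 0 <= energy T.
Proof.
elim: T => [a b [a0 _]|l IHl r IHr [/IHl hl /IHr hr]].
  by rewrite /energy /= mulr_ge0 ?sqr_ge0 ?ltW.
by rewrite /energy /= divr_ge0 ?addr_ge0.
Qed.

Lemma laplace_ge0 t T : admissible T -> 0 <= laplace t T.
Proof.
elim: T => [a b|l IHl r IHr] /=; first by case=> /ltW.
move=> [/IHl hl /IHr hr]; rewrite mulr_ge0 ?expR_ge0// divr_ge0 ?addr_ge0//.
Qed.

Lemma A2_le_root A T : A2_le A T -> wmean T * smean T <= A.
Proof. by case: T => [a b []|l r []]. Qed.

Lemma laplace_jump_le t l r q : admissible l -> admissible r ->
  q <= t * jump l r ^+ 2 ->
  laplace t (Node l r) <= expR (- q) * ((laplace t l + laplace t r) / 2).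
Proof.
move=> hl hr hq /=.
by rewrite ler_wpM2r ?ler_expR ?lerN2// divr_ge0 ?addr_ge0 ?laplace_ge0.
Qed.

Lemma laplace_node_le t l r : 0 <= t -> admissible l -> admissible r ->
  laplace t (Node l r) <= (laplace t l + laplace t r) / 2.
Proof.
move=> t0 hl hr /=; rewrite ler_piMl ?divr_ge0 ?addr_ge0 ?laplace_ge0//.
by rewrite -expR0 ler_expR lerNl oppr0 mulr_ge0 ?sqr_ge0.
Qed.

(** The exponential Markov inequality, for the part of the mass of [w] on which
    the accumulated square stays below [L]. *)
Lemma sqmean_tail t L s T : 0 <= t -> admissible T ->
  wmean T - expR (t * (L - s)) * laplace t T <=
  sqmean (fun a _ s => if L <= s then a else 0) s T.
Proof.
move=> t0; elim: T s => [a b s /= [a0 _]|l IHl r IHr s /= [hl hr]].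
  case: ifPn => [Ls|]; rewrite /wmean /=.
    by rewrite lerBlDr lerDl mulr_ge0 ?expR_ge0 ?ltW.
  rewrite -ltNge => /ltW Ls; rewrite subr_le0 ler_peMl ?(ltW a0)//.
  by rewrite -[X in X <= _]expR0 ler_expR mulr_ge0 ?subr_ge0.
set J := jump l r ^+ 2.
have := IHl (s + J) hl; have := IHr (s + J) hr.
have -> : t * (L - (s + J)) = t * (L - s) + - (t * J) by ring.
rewrite expRD /wmean /=.
set e1 := expR (t * _); set e2 := expR (- _).
move=> h1 h2; lra.
Qed.

(** * The moves of the game *)

(** Replaces a cell by one of relative size [2^-i]; the discarded cells have
    [f = 0] and the small weight [d]. *)
Fixpoint concentrate (d : R) (i : nat) T : dtree R :=
  if i is i'.+1 then Node (Leaf d 0) (concentrate d i' T) else T.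

(** One round of the game, on a cell where [w] has average [M].  The right half
    goes on with half the average, hence with a quarter of the mass of [w],
    while [f] and [w^-1] (which live mostly on the last leaf) double their
    averages.  The left half takes the other three quarters of the mass of [w]
    out of the round, and is filled with [C].  The weight [dl * M] of the final
    leaf is small, so [w^-1] is large there: this is what makes a large value
    [F] of [f] cheap in [L^2(w)]. *)
Fixpoint doubling (dl F : R) (C : R -> dtree R) (i : nat) (M : R) : dtree R :=
  if i is i'.+1 then Node (C (3 / 2 * M)) (doubling dl F C i' (M / 2))
  else Node (C ((2 - dl) * M)) (Leaf (dl * M) F).

Lemma tmean_concentrate h d i T :
  tmean h (concentrate d i T) = (1 - 2 ^- i) * h d 0 + 2 ^- i * tmean h T.
Proof.
elim: i => [|i IH] /=; first by rewrite expr0 invr1; ring.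
by rewrite IH exprS invfM; field; rewrite expf_neq0.
Qed.

Lemma exp2V01 i : 0 < (2 ^- i : R) <= 1.
Proof.
by rewrite invr_gt0 exprn_gt0//= invf_le1 ?exprn_gt0// exprn_ege1// ler1n.
Qed.

Lemma admissible_concentrate d i T :
  0 < d -> admissible T -> admissible (concentrate d i T).
Proof. by move=> d0 hT; elim: i. Qed.

Lemma laplace_concentrate t d i T : 0 <= t -> 0 < d -> admissible T ->
  laplace t (concentrate d i T) <= d + 2 ^- i * laplace t T.
Proof.
move=> t0 d0 hT; suff : laplace t (concentrate d i T) <=
    (1 - 2 ^- i) * d + 2 ^- i * laplace t T.
  move/le_trans; apply; rewrite lerD2r ler_piMl ?(ltW d0)//.
elim: i => [|i IH]; first by rewrite expr0 invr1/=; lra.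
apply: (le_trans (laplace_node_le t0 _ _)) => //=; first exact: admissible_concentrate.
rewrite exprS invfM -[2^-1 * _ * _]mulrA.
set q := 2 ^- i in IH *; set x := laplace _ _ in IH *; set y := laplace _ _ in IH *.
have -> : (1 - 2^-1 * q) * d + 2^-1 * (q * y) = (d + ((1 - q) * d + q * y)) / 2.
  by field.
by rewrite ler_pM2r// lerD2l.
Qed.

(** With [q] the proportion kept, the product of the two averages is a
    combination of [wmean T * smean T], [wmean T / d], [d * smean T] and [1]
    with coefficients at most [1]. *)
Lemma A2_le_concentrate A V d i T : 0 < d -> admissible T -> A2_le A T ->
  d <= wmean T -> wmean T * smean T <= V ->
  2 * V + wmean T / d + 1 <= A -> 1 <= A -> A2_le A (concentrate d i T).
Proof.
move=> d0 hT hA dW hV VA A1; elim: i => //= i IH; split; last first.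
  by split => //; split => //; rewrite /wmean /smean /= mulfV ?gt_eqF.
apply: le_trans VA; rewrite -[Node _ _]/(concentrate d i.+1 T) /wmean /smean.
rewrite !tmean_concentrate.
rewrite -/(wmean T) -/(smean T) /=.
have /andP[] := exp2V01 i.+1; set q := 2 ^- _ => q0 q1.
have s0 := smean_gt0 hT; have w0 := wmean_gt0 hT.
set W := wmean T in dW hV w0 *; set S := smean T in hV s0 *.
have WS : 0 < W * S by rewrite mulr_gt0.
have dS : d * S <= V by apply: le_trans hV; rewrite ler_wpM2r// ltW.
have Wd : 0 < W / d by rewrite divr_gt0.
have -> : ((1 - q) * d + q * W) * ((1 - q) * d^-1 + q * S) =
  (1 - q) ^+ 2 + q * (1 - q) * (d * S) + q * (1 - q) * (W / d) + q ^+ 2 * (W * S).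
  by field; rewrite gt_eqF.
have : 0 <= q * (1 - q) <= 1 by nra.
have : 0 <= q ^+ 2 <= 1 by nra.
have : 0 <= (1 - q) ^+ 2 <= 1 by nra.
have : 0 < d * S by rewrite mulr_gt0.
move: (q * (1 - q)) (q ^+ 2) ((1 - q) ^+ 2) (d * S) (W / d) (W * S) dS Wd WS hV.
move=> a b c x y z *; nra.
Qed.

(** The features of a family of trees [C m], [m] being the average of [w], that
    pass through the moves of the game.  All of them are invariant under the
    scaling of [w] by a constant, whence the normalizations by [m]. *)
Record profile (A t : R) (C : R -> dtree R) (c p kap ell : R) : Prop := Profile {
  profile_pos : forall m, 0 < m -> admissible (C m);
  profile_w : forall m, 0 < m -> wmean (C m) = m;
  profile_s : forall m, 0 < m -> smean (C m) * m <= c;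
  profile_f : forall m, 0 < m -> 0 <= fmean (C m) <= p;
  profile_e : forall m, 0 < m -> energy (C m) <= kap * m;
  profile_l : forall m, 0 < m -> laplace t (C m) <= ell * m;
  profile_A2 : forall m, 0 < m -> A2_le A (C m) }.

(** The dilution of [C] keeps the average [m] of [w], and almost all its mass
    goes to a subcell of relative size [2^-k].  There the average of [w] is
    multiplied by nearly [2^k], while the averages of [f] and of [w^-1] over the
    whole cell are [2^-k] times those over the subcell, up to the contribution
    of the discarded cells to the latter.  Hence diluted trees can be hung on the left halves of a round
    without spoiling the A_2 bound along that round. *)
Definition dilute (eps : R) (k : nat) (C : R -> dtree R) (m : R) : dtree R :=
  concentrate (eps * m) k (C ((2 ^+ k * (1 - eps) + eps) * m)).

Lemma profile_dilute A t C V p kap ell eps k :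
  0 <= t -> 0 < eps <= 2^-1 -> 0 <= V -> 0 <= p -> 0 <= kap -> 0 <= ell ->
  1 <= A -> 2 * V + (2 ^+ k / eps + 1) + 1 <= A ->
  profile A t C V p kap ell ->
  profile A t (dilute eps k C)
    (eps^-1 + 2 * 2 ^- k ^+ 2 * V) (2 ^- k * p) kap (eps + ell).
Proof.
move=> t0 /andP[e0 e1] V0 p0 kap0 ell0 A1 VA H.
have /andP[q0 q1] := exp2V01 k; pose g := 2 ^+ k * (1 - eps) + eps.
have k0 : 0 < 2 ^+ k :> R by rewrite exprn_gt0.
have k1 : 1 <= 2 ^+ k :> R by rewrite exprn_ege1// ler1n.
have qk : 2 ^- k * 2 ^+ k = 1 :> R by rewrite mulVf// gt_eqF.
have g0 : 0 < g by rewrite /g; nra.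
have qg : 2 ^- k * g = 1 - eps + 2 ^- k * eps by rewrite /g mulrDr mulrA qk; ring.
have gm m : 0 < m -> 0 < g * m by move=> m0; rewrite mulr_gt0.
have em m : 0 < m -> 0 < eps * m by move=> m0; rewrite mulr_gt0.
have qg1 : 2 ^- k * g <= 1 by rewrite qg; nra.
have qg2 : 2^-1 <= 2 ^- k * g by rewrite qg; nra.
have ge : eps <= g by rewrite /g; nra.
have gle : g / eps <= 2 ^+ k / eps + 1.
  rewrite /g mulrDl mulfV ?gt_eqF// lerD2r ler_pM2r ?invr_gt0//.
  by rewrite ler_piMr ?ltW//; lra.
split=> m m0; rewrite /dilute -/g.
- by apply: admissible_concentrate; [exact: em|apply: (profile_pos H); exact: gm].
- rewrite /wmean tmean_concentrate -/(wmean _) (profile_w H) ?gm//=.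
  have -> : (1 - 2 ^- k) * (eps * m) + 2 ^- k * (g * m) =
    ((1 - 2 ^- k) * eps + 2 ^- k * g) * m by ring.
  by rewrite qg; ring.
- rewrite /smean tmean_concentrate -/(smean _) mulrDl lerD//.
    rewrite invfM mulrA mulfVK ?gt_eqF// ler_piMl ?invr_ge0 ?ltW//; lra.
  have := profile_s H (gm _ m0); set S := smean _ => h.
  have -> : 2 ^- k * S * m = 2 ^- k / g * (S * (g * m)) by field; rewrite !gt_eqF.
  apply: (le_trans (ler_wpM2l _ h)); first by rewrite divr_ge0 ?ltW.
  rewrite ler_wpM2r// ler_pdivrMr//.
  have -> : 2 * 2 ^- k ^+ 2 * g = 2 ^- k * (2 * (2 ^- k * g)) by ring.
  by rewrite ler_peMr ?(ltW q0)//; lra.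
- rewrite /fmean tmean_concentrate -/(fmean _) mulr0 add0r.
  have /andP[h1 h2] := profile_f H (gm _ m0).
  by rewrite mulr_ge0 ?(ltW q0)//= ler_wpM2l ?(ltW q0).
- rewrite /energy tmean_concentrate -/(energy _) expr0n/= mul0r mulr0 add0r.
  apply: (le_trans (ler_wpM2l (ltW q0) (profile_e H (gm _ m0)))).
  have -> : 2 ^- k * (kap * (g * m)) = 2 ^- k * g * (kap * m) by ring.
  by rewrite ler_piMl// mulr_ge0// ltW.
- apply: (le_trans (laplace_concentrate _ t0 (em _ m0) (profile_pos H (gm _ m0)))).
  rewrite [(eps + ell) * m]mulrDl lerD2l.
  apply: (le_trans (ler_wpM2l (ltW q0) (profile_l H (gm _ m0)))).
  have -> : 2 ^- k * (ell * (g * m)) = 2 ^- k * g * (ell * m) by ring.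
  by rewrite ler_piMl// mulr_ge0// ltW.
- have w := profile_w H (gm _ m0).
  apply: (@A2_le_concentrate _ V) => //; rewrite ?w.
  + exact: em.
  + by apply: (profile_pos H); exact: gm.
  + by apply: (profile_A2 H); exact: gm.
  + by rewrite ler_pM2r.
  + by rewrite mulrC; exact: (profile_s H (gm _ m0)).
  + apply: le_trans VA; rewrite !lerD2r lerD2l (_ : _ / _ = g / eps)//.
    by field; rewrite !gt_eqF.
Qed.
End Trees.

Section Rounds.
Context {R : realType}.
Implicit Types (T l r : dtree R) (d t : R).

Lemma exprN_le_half (x : R) : 0 <= x <= 1 -> expR (- x) <= 1 - x / 2.
Proof.
move=> /andP[x0 x1]; rewrite expRN.
apply: (@le_trans _ _ (1 + x)^-1).
  by rewrite lef_pV2 ?posrE ?expR_gt0 ?expR_ge1Dx//; lra.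
by rewrite invf_ple ?posrE; [|lra|lra]; rewrite -div1r ler_pdivrMr; nra.
Qed.

Lemma exp4V i : (4 : R) ^- i = 2 ^- i ^+ 2.
Proof. by rewrite -exprVn -exprM muln2 -mul2n exprM expr2 -invfM -natrM exprVn. Qed.

(** The final leaf alone contributes [1 / (2 * dl)], at every stage of the
    round: both the average of [w] and the proportion of the cell that the
    leaf occupies behave like powers of two. *)
Lemma doubling_smean_ge (C : R -> dtree R) (dl F : R) i M : 0 < dl <= 1 ->
  (forall m, 0 < m -> admissible (C m)) -> 0 < M ->
  (2 * dl)^-1 <= smean (doubling dl F C i M) * M.
Proof.
move=> /andP[d0 d1] hC; elim: i M => [|i IH] M M0 /=.
  have /hC /smean_gt0 : 0 < (2 - dl) * M by rewrite mulr_gt0//; lra.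
  rewrite {2}/smean /= -/(smean _); set s := smean _ => s0.
  have -> : (s + (dl * M)^-1) / 2 * M = s / 2 * M + (2 * dl)^-1.
    by field; rewrite !gt_eqF.
  by rewrite lerDr mulr_ge0 ?divr_ge0// ltW.
have M2 : 0 < M / 2 by lra.
have /hC /smean_gt0 : 0 < 3 / 2 * M by lra.
rewrite {2}/smean /= -!/(smean _); set s := smean _ => s0.
apply: (le_trans (IH _ M2)).
have : 0 <= s * M by rewrite mulr_ge0 ?ltW.
by move: (smean _) => x; lra.
Qed.

(** Let [i] be the number of doublings left.  Normalized by [M], the average of
    [w^-1] satisfies [x_(i+1) <= x_i + c / 3] and the energy
    [x_(i+1) <= 3/4 kap + 1/4 x_i].  The average of [f] halves when [i]
    increases, up to the diluted trees, which have average at most [1].  For the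
    Laplace transform, the jump [J] of the step from [i+1] to [i] satisfies
    [t J^2 >= 4^-(i+1)], so that the three quarters of the mass that leave
    the round contribute at most [3/4 ell (1 - 4^-(i+1) / 2)]: each of the [i]
    steps of the round thus gains the same amount [3/8 4^-i].  This equality of
    the contributions is the St. Petersburg phenomenon. *)
Lemma doubling_bounds (A t : R) C (c p kap ell dl F : R) (k : nat) :
  0 <= t -> 0 < dl <= 1 -> 0 <= c -> 0 <= kap -> 0 <= ell -> p <= 1 ->
  F = 2 * 2 ^+ k -> 4 / 2 ^+ k ^+ 2 <= t -> 1 <= A ->
  (2 * dl)^-1 + c * (2^-1 + k%:R / 3) <= A ->
  profile A t C c p kap ell ->
  forall i M, (i <= k)%N -> 0 < M ->
  let T := doubling dl F C i M in
  [/\ admissible T, wmean T = M,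
      smean T * M <= (2 * dl)^-1 + c * (2^-1 + i%:R / 3) &
      [/\ F / 2 * 2 ^- i <= fmean T <= F / 2 * 2 ^- i + 1,
      energy T <= (kap + 4 ^- i * (F ^+ 2 * dl / 2)) * M,
      laplace t T <= (ell * (1 - 3 / 8 * i%:R * 4 ^- i) + dl / 2) * M &
      A2_le A T]].
Proof.
move=> t0 /andP[dl0 dl1] c0 kap0 ell0 p1 FE tk A1 cA H.
have F0 : 0 < F by rewrite FE mulr_gt0// exprn_gt0.
elim => [|i IH] M ik M0 /=.
  have m0 : 0 < (2 - dl) * M by rewrite mulr_gt0//; lra.
  have dM : 0 < dl * M by rewrite mulr_gt0.
  have W : wmean (Node (C ((2 - dl) * M)) (Leaf (dl * M) F)) = M.
    by rewrite /wmean /= -/(wmean _) (profile_w H)//; field.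
  have S1 : smean (Node (C ((2 - dl) * M)) (Leaf (dl * M) F)) * M =
    (2 * dl)^-1 + smean (C ((2 - dl) * M)) * ((2 - dl) * M) / (2 * (2 - dl)).
    rewrite /smean /= -/(smean _); field.
    by rewrite !gt_eqF//; lra.
  have s0 : 0 < smean (C ((2 - dl) * M)) * ((2 - dl) * M).
    by rewrite mulr_gt0// smean_gt0//; exact: (profile_pos H).
  have S2 : smean (Node (C ((2 - dl) * M)) (Leaf (dl * M) F)) * M <=
     (2 * dl)^-1 + c * (2^-1 + 0%:R / 3).
    rewrite S1 mul0r addr0 lerD2l; apply: ler_pM.
    - exact: ltW.
    - by rewrite invr_ge0; lra.
    - exact: (profile_s H).
    - by rewrite lef_pV2 ?posrE; lra.
  split => //.
  - by do 2?split; rewrite ?(ltW F0)//; exact: (profile_pos H).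
  - rewrite !expr0 invr1 !mulr1 mul1r; split.
    + rewrite /fmean /= -/(fmean _).
      have /andP[] := profile_f H m0; lra.
    + rewrite /energy /= -/(energy _).
      have := profile_e H m0; set E := energy _ => hE.
      have : 0 <= kap * (dl * M) by rewrite mulr_ge0// ltW.
      set FF := F ^+ 2; lra.
    + apply: (le_trans (laplace_node_le t0 (profile_pos H m0) _)) => /=.
        by split=> //; exact: ltW.
      have := profile_l H m0; set E := laplace _ _ => hE.
      have : 0 <= ell * (dl * M) by rewrite mulr_ge0// ltW.
      lra.
    + split; last first.
        split; first exact: (profile_A2 H).
        by split=> //; rewrite /wmean /smean /= mulfV ?gt_eqF.
      rewrite W mulrC; apply: (le_trans S2); apply: le_trans cA.
      by rewrite lerD2l ler_wpM2l// lerD2l mul0r divr_ge0.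
have m0 : 0 < 3 / 2 * M by lra.
have m1 : 0 < M / 2 by lra.
have [h1 h2 h3 [/andP[h4 h4'] h5 h6 h7]] := IH _ (ltnW ik) m1.
move: h1 h2 h3 h4 h4' h5 h6 h7; set T := doubling _ _ _ _ _ => h1 h2 h3 h4 h4' h5 h6 h7.
have p0 := profile_pos H m0.
have W : wmean (Node (C (3 / 2 * M)) T) = M.
  by rewrite /wmean /= -!/(wmean _) (profile_w H)// h2; field.
have S1 : smean (Node (C (3 / 2 * M)) T) * M =
    smean (C (3 / 2 * M)) * (3 / 2 * M) / 3 + smean T * (M / 2).
  by rewrite /smean /= -!/(smean _); field.
have s0 : 0 < smean (C (3 / 2 * M)) by rewrite smean_gt0.
have S2 : smean (Node (C (3 / 2 * M)) T) * M <=
   (2 * dl)^-1 + c * (2^-1 + i.+1%:R / 3).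
  have -> : c * (2^-1 + i.+1%:R / 3) = c / 3 + c * (2^-1 + i%:R / 3).
    by rewrite -[i.+1%:R]natr1; field.
  rewrite S1 addrCA; apply: lerD => //; rewrite ler_pM2r ?invr_gt0//.
  exact: (profile_s H).
have /andP[f0 f1] := profile_f H m0.
have F2 : 0 < F / 2 by rewrite divr_gt0.
have /andP[q0 q1] := @exp2V01 R i.
split => //.
- rewrite [2 ^+ i.+1]exprSr [4 ^+ i.+1]exprSr !invfM.
  split.
  + rewrite /fmean /= -!/(fmean _).
    move: h4 h4'; rewrite mulrA; set x := F / 2 * _ => h4 h4'.
    lra.
  + rewrite /energy /= -!/(energy _).
    have := profile_e H m0; set E1 := energy _; move: h5; set E2 := energy _.
    set FF := F ^+ 2 * dl / 2; set q4 := 4 ^- i => h5 h5'.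
    lra.
  + have J : 4 ^- i / 4 <= t * jump (C (3 / 2 * M)) T ^+ 2.
      rewrite exp4V /jump.
      set q := 2 ^- i in q0 q1 h4 *; set N := 2 ^+ k in FE tk.
      have N0 : 0 < N by rewrite exprn_gt0.
      have Nq : 2 <= N * q.
        have -> : N = 2 * 2 ^+ (k - i.+1) * 2 ^+ i.
          by rewrite -exprS -exprD addSnnS subnK.
        by rewrite mulfK ?expf_neq0// ler_peMr// exprn_ege1// ler1n.
      have hT : N * q <= fmean T by move: h4; rewrite FE; lra.
      (* The average of the sibling is at most 1, and N * q is at least 2. *)
      have : N * q / 4 <= - ((fmean (C (3 / 2 * M)) - fmean T) / 2) by lra.
      set j := (_ - _) / 2 => hj; have hj2 : (N * q / 4) ^+ 2 <= j ^+ 2.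
        by rewrite -[j ^+ 2]sqrrN ler_sqr ?nnegrE//; lra.
      apply: (@le_trans _ _ (4 / N ^+ 2 * (N * q / 4) ^+ 2)).
        by rewrite le_eqVlt; apply/orP; left; apply/eqP; field; rewrite gt_eqF.
      by apply: ler_pM => //; rewrite ?sqr_ge0// divr_ge0// sqr_ge0.
    apply: (le_trans (laplace_jump_le p0 h1 J)).
    have q4 : 0 < (4 : R) ^- i <= 1.
      by rewrite exp4V exprn_gt0//= expr_le1// ltW.
    have := @exprN_le_half (4 ^- i / 4); have := expR_ge0 (- (4 ^- i / 4) : R).
    set e := expR _ => e0 he; have {}he : e <= 1 - 4 ^- i / 4 / 2 by apply: he; lra.
    have := profile_l H m0; move: h6; have := laplace_ge0 t p0; have := laplace_ge0 t h1.
    set l1 := laplace _ _; set l2 := laplace _ _ => l10 l20 hl1 hl2.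
    (* The gain is used on the part that leaves the round only. *)
    apply: (@le_trans _ _ ((1 - 4 ^- i / 4 / 2) * (l2 / 2) + l1 / 2)).
      rewrite mulrDl mulrDr lerD// ?ler_wpM2r ?divr_ge0//.
      by rewrite ler_piMl ?divr_ge0//; lra.
    have : (1 - 4 ^- i / 4 / 2) * (l2 / 2) <=
        (1 - 4 ^- i / 4 / 2) * (ell * (3 / 2 * M) / 2).
      by rewrite ler_wpM2l ?ler_pM2r//; lra.
    have : 0 <= dl * M by rewrite mulr_ge0 ?ltW.
    rewrite -[i.+1%:R]natr1; set q := 4 ^- i in hl1 q4 *; set n := i%:R in hl1 *.
    clear -hl1; lra.
  + split; last by split => //; exact: (profile_A2 H).
    rewrite W mulrC; apply: (le_trans S2); apply: le_trans cA.
    rewrite lerD2l ler_wpM2l// lerD2l ler_pM2r ?invr_gt0// ler_nat//.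
Qed.
End Rounds.

(** * The iterated game *)

Section Game.
Context {R : realType}.
Implicit Types (T : dtree R) (d t : R).

(** [r] rounds of the game, with [k] doublings in each.  Writing [N = 2^k], the
    final leaves have relative weight [N^-6], which makes the A_2
    characteristic comparable with [N^6]; the discarded cells have relative
    weight [N^-4], large enough for their [w^-1] to be negligible against
    [N^6], and small enough for [N^2] rounds to lose a small part of the mass
    of [w].  The value [2 * N] makes the average of [f] at the start of a round
    about [1]. *)
Fixpoint game (k r : nat) (m : R) : dtree R :=
  if r is r'.+1 then
    doubling (2 ^- k ^+ 6) (2 * 2 ^+ k) (dilute (2 ^- k ^+ 4) k (game k r')) k m
  else Leaf m 0.

(** The relative loss of the Laplace transform in one round, at
    [t = 4 * 4^-k]. *)
Definition decay k : R := 3 / 8 * k%:R * 4 ^- k.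

Lemma ltn_exp2R k : k%:R + 1 <= 2 ^+ k :> R.
Proof. by rewrite natr1 -natrX ler_nat ltn_expl. Qed.

Lemma decay01 k : 0 <= 1 - decay k <= 1.
Proof.
have k0 : 0 < 2 ^+ k :> R by rewrite exprn_gt0.
have k0' : 0 <= k%:R :> R by [].
have h := ltn_exp2R k.
have : 0 <= decay k <= 1.
  rewrite /decay exp4V exprVn ler_pdivrMr ?exprn_gt0// divr_ge0 ?sqr_ge0//=.
  by nra.
by move=> /andP[]; lra.
Qed.

(** Each round costs [2 N^-6] in energy and multiplies the Laplace transform by
    [1 - decay k], up to the mass lost in the discarded cells and in the final
    leaf.  The average of [w^-1] stays below [N^6] for every number of rounds,
    since dilution divides the contribution of the previous rounds by [N^2]. *)
Lemma game_profile k r : (2 <= k)%N ->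
  profile (4 * (2 ^+ k) ^+ 6) (4 / 2 ^+ k ^+ 2) (game k r) ((2 ^+ k) ^+ 6) 2
    (2 * 2 ^- k ^+ 6 * r%:R)
    ((1 - decay k) ^+ r + r%:R * (2 ^- k ^+ 4 + 2 ^- k ^+ 6)).
Proof.
move=> k2; have kN := ltn_exp2R k; set N := 2 ^+ k in kN *.
have k2R : 2 <= k%:R :> R by rewrite ler_nat.
have N3 : 3 <= N by lra.
have N0 : 0 < N by lra.
have N60 : 0 < N ^+ 6 by rewrite exprn_gt0.
have N1 n : 1 <= N ^+ n by rewrite exprn_ege1//; lra.
have N61 := N1 6%N.
have q1 n : 0 < N^-1 ^+ n <= 1.
  by rewrite exprn_gt0 ?invr_gt0//= exprVn invf_le1 ?exprn_gt0.
have t0 : 0 <= 4 / N ^+ 2 by rewrite divr_ge0// sqr_ge0.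
elim: r => [|r IH].
  split=> m m0 /=.
  - by [].
  - by [].
  - by rewrite /smean /= mulVf ?gt_eqF.
  - by rewrite /fmean /=; lra.
  - by rewrite /energy /= expr0n /= !mul0r mulr0 mul0r.
  - by rewrite expr0 mul0r addr0 mul1r.
  - by split => //; rewrite /wmean /smean /= mulfV ?gt_eqF//; lra.
have /andP[e0 e1] := q1 4%N; have /andP[d0 d1] := q1 6%N.
have e2 : N^-1 ^+ 4 <= 2^-1.
  rewrite exprVn lef_pV2 ?posrE ?exprn_gt0//; apply: (@le_trans _ _ N); first lra.
  by rewrite exprS ler_peMr// ltW.
set ell := _ ^+ r + _ in IH.
have /andP[dec0 dec1] := decay01 k.
have ell0 : 0 <= ell.
  rewrite addr_ge0 ?exprn_ge0// mulr_ge0// addr_ge0 ?ltW//.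
have kap0 : 0 <= 2 * N^-1 ^+ 6 * r%:R by rewrite mulr_ge0// mulr_ge0// ltW.
have D : profile (4 * N ^+ 6) (4 / N ^+ 2) (dilute (N^-1 ^+ 4) k (game k r))
   (3 * N ^+ 4) 1 (2 * N^-1 ^+ 6 * r%:R) (N^-1 ^+ 4 + ell).
  have := @profile_dilute _ (4 * N ^+ 6) _ _ _ _ _ _ (N^-1 ^+ 4) k t0 _ _ _ kap0 ell0 _ _ IH.
  rewrite -/N e0 e2 => /(_ isT (ltW N60) (ler0n _ _)).
  have -> : (N^-1 ^+ 4)^-1 + 2 * N^-1 ^+ 2 * N ^+ 6 = 3 * N ^+ 4.
    by field; rewrite gt_eqF.
  have h1 : 1 <= 4 * N ^+ 6 by lra.
  have h2 : 2 * N ^+ 6 + (N / N^-1 ^+ 4 + 1) + 1 <= 4 * N ^+ 6.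
    have -> : N / N^-1 ^+ 4 = N ^+ 5 by field; rewrite gt_eqF.
    have : N ^+ 6 = N ^+ 5 * N by rewrite exprSr.
    have := N1 5%N; set x := N ^+ 5; set y := N ^+ 6; nra.
  move=> /(_ h1 h2) [p1 p2 p3 p4 p5 p6 p7].
  split=> // m m0; have /andP[-> h] := p4 _ m0; apply: (le_trans h).
  by rewrite mulrC ler_pdivrMr//; lra.
have c0 : 0 <= 3 * N ^+ 4 by rewrite mulr_ge0// exprn_ge0// ltW.
have AV : (2 * N^-1 ^+ 6)^-1 + 3 * N ^+ 4 * (2^-1 + k%:R / 3) <= N ^+ 6.
  have -> : (2 * N^-1 ^+ 6)^-1 = N ^+ 6 / 2 by field; rewrite gt_eqF.
  have -> : N ^+ 6 = N ^+ 4 * N ^+ 2 by rewrite -exprD.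
  have : 2 * k%:R + 3 <= N ^+ 2 by nra.
  have := N1 4%N; set x := N ^+ 4; set y := N ^+ 2; nra.
have AA : (2 * N^-1 ^+ 6)^-1 + 3 * N ^+ 4 * (2^-1 + k%:R / 3) <= 4 * N ^+ 6 by lra.
have ell'0 : 0 <= N^-1 ^+ 4 + ell by rewrite addr_ge0// ltW.
have d01 : 0 < N^-1 ^+ 6 <= 1 by rewrite d0.
have A1 : 1 <= 4 * N ^+ 6 by lra.
have S := @doubling_bounds R _ _ _ _ _ _ _ _ _ k t0 d01 c0 kap0 ell'0 (lexx _)
  (erefl _) (lexx _) A1 AA D.
split=> m m0; have [h1 h2 h4 [/andP[h5 h6] h7 h8 h9]] := S k m (leqnn _) m0.
- exact: h1.
- exact: h2.
- exact: le_trans h4 AV.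
- move: h5 h6; rewrite -/N mulrAC mulfK ?gt_eqF// divff ?gt_eqF// => h5 h6.
  have -> : 2 = 1 + 1 :> R by [].
  by rewrite h6 (le_trans _ h5).
- apply: (le_trans h7); rewrite ler_pM2r// exp4V -/N le_eqVlt; apply/orP; left; apply/eqP.
  by rewrite -natr1; field; rewrite gt_eqF.
- apply: (le_trans h8); rewrite ler_pM2r// -/(decay k) -/N.
  rewrite /ell [_ ^+ r.+1]exprS -[r.+1%:R]natr1.
  move: dec0 dec1 e0 d0; set a := 1 - decay k; set x := a ^+ r.
  move: (N^-1 ^+ 4) (N^-1 ^+ 6) => e d dec0 dec1 e0 d0.
  have : a * (e + r%:R * (e + d)) <= e + r%:R * (e + d).
    have ed0 : 0 <= e + d by lra.
    by rewrite ler_piMl// addr_ge0 ?(ltW e0)// mulr_ge0.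
  by rewrite -/(decay k) -/a; lra.
- exact: h9.
Qed.

Lemma game_smean_ge k r : (2 <= k)%N ->
  (2 ^+ k) ^+ 6 / 2 <= smean (game k r.+1 1).
Proof.
move=> k2; have H := @game_profile k r k2.
have k0 : 0 < 2 ^+ k :> R by rewrite exprn_gt0.
have k1 : 1 <= 2 ^+ k :> R by rewrite exprn_ege1// ler1n.
have -> : (2 ^+ k) ^+ 6 / 2 = (2 * 2 ^- k ^+ 6)^-1 :> R by field; rewrite gt_eqF.
rewrite -[leRHS]mulr1; apply: doubling_smean_ge => // [|m m0].
  by rewrite exprn_gt0 ?invr_gt0//= exprVn invf_le1 ?exprn_gt0// exprn_ege1.
apply: admissible_concentrate; first by rewrite mulr_gt0// exprn_gt0// invr_gt0.
apply: (profile_pos H); rewrite mulr_gt0// addrC.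
have e1 : 2 ^- k ^+ 4 <= 1 :> R by rewrite exprVn invf_le1 ?exprn_gt0// exprn_ege1.
by rewrite ltr_wpDr ?mulr_ge0 ?subr_ge0 ?(ltW k0)// exprn_gt0 ?invr_gt0.
Qed.
End Game.

Section Outcome.
Context {R : realType}.
Implicit Types (N : R) (k : nat).

Lemma exp2_sqr k : (4 ^ k)%:R = (2 ^+ k) ^+ 2 :> R.
Proof. by rewrite natrX -exprM mulnC exprM; congr (_ ^+ _); ring. Qed.

(** With [t = 4 * 4^-k], the factor of the Markov inequality at the level
    [k 4^k / 32] is [exp (k / 8)], at most [2^k].  It beats both parts of the
    Laplace transform after [4^k] rounds: the main part, at most
    [exp (- 3 k / 8)], and the mass lost on the way, at most [2 * 4^-k]. *)
Lemma game_sqmean_ge k : (12 <= k)%N ->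
  2^-1 <= sqmean (fun a _ s => if k%:R * (2 ^+ k) ^+ 2 / 32 <= s then a else 0) 0
    (game k (4 ^ k) 1 : dtree R).
Proof.
move=> k12; have kN := @ltn_exp2R R k.
have H := @game_profile R k (4 ^ k) (leq_trans (isT : (2 <= 12)%N) k12).
have k12R : 12 <= k%:R :> R by rewrite ler_nat.
set N := 2 ^+ k in kN H *.
have N0 : 0 < N by lra.
have t0 : 0 <= 4 / N ^+ 2 by rewrite divr_ge0// sqr_ge0.
apply: le_trans (sqmean_tail _ 0 t0 (profile_pos H ltr01)).
rewrite (profile_w H)// subr0.
have -> : 4 / N ^+ 2 * (k%:R * N ^+ 2 / 32) = k%:R / 8 by field; rewrite gt_eqF.
have := profile_l H ltr01; rewrite mulr1 exp2_sqr -/N.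
set l := laplace _ _ => hl.
have e0 := expR_gt0 (k%:R / 8 : R).
have eN : expR (k%:R / 8) <= N.
  rewrite mulrC expRM_natr lerXn2r ?nnegrE ?expR_ge0//.
  have := expR_ge1Dx (- 8^-1 : R); have := expR_gt0 (8^-1 : R).
  rewrite expRN; set y := expR _ => y0 hy.
  have : y * (1 - 8^-1) <= y * y^-1 by rewrite ler_pM2l.
  by rewrite mulfV ?gt_eqF//; lra.
have hx : (1 - decay k) ^+ (4 ^ k) <= expR (- (3 / 8 * k%:R)) :> R.
  have /andP[d0 _] := @decay01 R k.
  apply: (@le_trans _ _ (expR (- decay k) ^+ (4 ^ k))).
    by rewrite lerXn2r ?nnegrE ?expR_ge0// expR_ge1Dx.
  rewrite -expRM_natr /decay exp2_sqr exp4V -/N le_eqVlt; apply/orP; left; apply/eqP.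
  by congr expR; field; rewrite gt_eqF.
have hy : expR (k%:R / 8) * expR (- (3 / 8 * k%:R)) <= 4^-1 :> R.
  rewrite -expRD (_ : _ + _ = - (k%:R / 4)); last by field.
  rewrite expRN lef_pV2 ?posrE ?expR_gt0//.
  by apply: le_trans (expR_ge1Dx _); lra.
have hz : N * (N ^+ 2 * (N^-1 ^+ 4 + N^-1 ^+ 6)) <= 4^-1.
  have -> : N * (N ^+ 2 * (N^-1 ^+ 4 + N^-1 ^+ 6)) = N^-1 + N^-1 ^+ 3.
    by field; rewrite gt_eqF.
  have h : N^-1 <= 13^-1 by rewrite lef_pV2 ?posrE//; lra.
  have h0 : 0 < N^-1 by rewrite invr_gt0.
  have : N^-1 ^+ 3 <= N^-1 by rewrite -[leRHS]expr1 ler_wiXn2l ?ltW//; lra.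
  lra.
have : expR (k%:R / 8) * l <= 2^-1 :> R.
  apply: (le_trans (ler_wpM2l (ltW e0) hl)); rewrite mulrDr.
  have : expR (k%:R / 8) * (1 - decay k) ^+ (4 ^ k) <= 4^-1 :> R.
    exact: (le_trans (ler_wpM2l (ltW e0) hx) hy).
  have : expR (k%:R / 8) * (N ^+ 2 * (N^-1 ^+ 4 + N^-1 ^+ 6)) <= 4^-1.
    apply: le_trans hz; rewrite ler_wpM2r// mulr_ge0 ?sqr_ge0// addr_ge0//.
      by rewrite exprn_ge0// invr_ge0 ltW.
    by rewrite exprn_ge0// invr_ge0 ltW.
  by move=> h1 h2; lra.
by lra.
Qed.

(** Both sides are of the order of [k N^2]: the powers [N^6] of the A_2 bound
    and [N^-6] of the energy cancel, and the logarithm of the A_2 bound is at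
    most [7 k]. *)
Lemma constant_comparison k (N : R) : (12 <= k)%N -> N = 2 ^+ k ->
  (expR (- 2) / 48) ^+ 2 * (4 * N ^+ 6 * ln (1 + 4 * N ^+ 6)) *
    (2 * N^-1 ^+ 6 * (4 ^ k)%:R) < k%:R * N ^+ 2 / 32 * 2^-1.
Proof.
move=> k12 NE; have kN := @ltn_exp2R R k.
have k12R : 12 <= k%:R :> R by rewrite ler_nat.
rewrite -NE in kN; have N0 : 0 < N by lra.
have N60 : 0 < N ^+ 6 by rewrite exprn_gt0.
have hln : ln (1 + 4 * N ^+ 6) <= 7 * k%:R.
  have h : 1 + 4 * N ^+ 6 <= N ^+ 7.
    rewrite [N ^+ 7]exprSr; have : 1 <= N ^+ 6 by rewrite exprn_ege1//; lra.
    by set x := N ^+ 6; nra.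
  apply: (@le_trans _ _ (ln (N ^+ 7))).
    by rewrite ler_ln ?posrE//; lra.
  rewrite lnXn// {1}NE lnXn// -[X in _ <= X]mulr1.
  have : ln (2 : R) <= 1 by have := @le_ln1Dx R 1; rewrite -[1 + 1]/2; apply; lra.
  set x := ln 2 => x1.
  rewrite -[x *+ k]mulr_natr -[_ *+ 7]mulr_natr; nra.
have e2 : (expR (- 2) / 48) ^+ 2 <= (144^-1 : R) ^+ 2.
  rewrite ler_sqr ?nnegrE ?divr_ge0 ?expR_ge0//.
  have := expR_ge1Dx (2 : R); rewrite expRN => h.
  have : (expR 2)^-1 <= 3^-1 :> R by rewrite lef_pV2 ?posrE ?expR_gt0//; lra.
  lra.
rewrite exp2_sqr -NE.
have -> : (expR (- 2) / 48) ^+ 2 * (4 * N ^+ 6 * ln (1 + 4 * N ^+ 6)) *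
    (2 * N^-1 ^+ 6 * N ^+ 2) =
    8 * N ^+ 2 * ((expR (- 2) / 48) ^+ 2 * ln (1 + 4 * N ^+ 6)).
  by field; rewrite gt_eqF.
have l0 : 0 <= ln (1 + 4 * N ^+ 6) by rewrite ln_ge0//; lra.
have := ler_pM (sqr_ge0 (expR (- 2) / 48)) l0 e2 hln.
set x := _ * ln _ => hx.
have N20 : 0 < N ^+ 2 by rewrite exprn_gt0.
have : 0 < N ^+ 2 * k%:R by rewrite mulr_gt0//; lra.
set y := N ^+ 2 in N20 *; nra.
Qed.
End Outcome.

(** * Trees as step functions *)

Section StepFunctions.
Context {R : realType}.
Implicit Types (T : dtree R) (x y : R).
Local Notation mu := (@lebesgue_measure R).
Local Notation I n j := ([set` dyadic_itv R n j] : set R).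

Definition midpoint (n j : nat) : R := j.*2.+1%:R * 2 ^- n.+1.

(** The function that [T] describes on the dyadic interval of index [(n, j)],
    read through [G]; the argument [s] is as in [sqmean]. *)
Fixpoint stepfun (G : R -> R -> R -> R) T n j (s x : R) : R :=
  match T with
  | Leaf a b => G a b s
  | Node l r =>
      let s' := s + jump l r ^+ 2 in
      if x < midpoint n j then stepfun G l n.+1 j.*2 s' x
      else stepfun G r n.+1 j.*2.+1 s' x
  end.

(** The subtree at depth [k] whose cell contains [x]; below a leaf, the leaf
    stands for all its subcells. *)
Fixpoint node_at (k : nat) T n j x : dtree R :=
  if k is k'.+1 then
    match T with
    | Leaf _ _ => T
    | Node l r =>
        if x < midpoint n j then node_at k' l n.+1 j.*2 x
        else node_at k' r n.+1 j.*2.+1 x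
    end
  else T.

Lemma stepfun_comp G T n j s x :
  stepfun G T n j s x = G (stepfun (fun a _ _ => a) T n j s x)
    (stepfun (fun _ b _ => b) T n j s x) (stepfun (fun _ _ s => s) T n j s x).
Proof. by elim: T n j s => //= l IHl r IHr n j s; case: ifP => _. Qed.

Lemma measurable_stepfun G T n j s : measurable_fun setT (stepfun G T n j s).
Proof.
elim: T n j s => [a b|l IHl r IHr] n j s /=; first exact: measurable_cst.
apply: measurable_fun_ifT => //.
by apply: measurable_fun_ltr => //; exact: measurable_cst.
Qed.

Lemma in_dyadic n j x : I n j x <-> j%:R * 2 ^- n <= x < j.+1%:R * 2 ^- n.
Proof. by rewrite /= in_itv. Qed.

(** Points of a dyadic interval are not separated by the grid of its
    generation; nestedness and disjointness of dyadic intervals are read off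
    from this. *)
Lemma dyadic_lt_grid m i p x : I m i x -> (x < p%:R * 2 ^- m) = (i < p)%N.
Proof.
move=> /in_dyadic /andP[h1 h2]; have m0 : 0 < 2 ^- m :> R by rewrite invr_gt0 exprn_gt0.
have [ip|pi] := ltnP i p.
  by apply: (lt_le_trans h2); rewrite ler_pM2r// ler_nat.
by apply/negbTE; rewrite -leNgt; apply: le_trans h1; rewrite ler_pM2r// ler_nat.
Qed.

Lemma dyadic_uniq n i j x : I n i x -> I n j x -> i = j.
Proof.
move=> hi hj; apply/eqP; rewrite eqn_leq [(i <= j)%N]leqNgt [(j <= i)%N]leqNgt.
rewrite -(dyadic_lt_grid j hi) (dyadic_lt_grid j hj) ltnn.
by rewrite -(dyadic_lt_grid i hj) (dyadic_lt_grid i hi) ltnn.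
Qed.

Lemma midpointE n j k : midpoint n j = (j.*2.+1 * 2 ^ k)%N%:R * 2 ^- (n.+1 + k).
Proof. by rewrite /midpoint natrM natrX exprD invfM; field; rewrite !expf_neq0. Qed.

Lemma dyadic_left n j x : I n.+1 j.*2 x <-> I n j x /\ x < midpoint n j.
Proof.
rewrite !in_dyadic /midpoint exprS invfM -!muln2 !natrM -[(j * 2).+1%:R]natr1 -[j.+1%:R]natr1 natrM.
set q := 2 ^- n; have q0 : 0 < q by rewrite invr_gt0 exprn_gt0.
split; first by move=> /andP[h1 h2]; split; [apply/andP; split|]; lra.
by move=> [/andP[h1 h2] h3]; apply/andP; split; lra.
Qed.

Lemma dyadic_right n j x : I n.+1 j.*2.+1 x <-> I n j x /\ ~~ (x < midpoint n j).
Proof.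
rewrite !in_dyadic /midpoint exprS invfM -!muln2.
rewrite -[(j * 2).+2%:R]natr1 -[(j * 2).+1%:R]natr1 -[j.+1%:R]natr1 natrM -leNgt.
set q := 2 ^- n; have q0 : 0 < q by rewrite invr_gt0 exprn_gt0.
split; first by move=> /andP[h1 h2]; split; [apply/andP; split|]; lra.
by move=> [/andP[h1 h2] h3]; apply/andP; split; lra.
Qed.

Lemma dyadic_splitU n j : I n j = I n.+1 j.*2 `|` I n.+1 j.*2.+1.
Proof.
apply/seteqP; split => x /=.
  move=> hx; case: (boolP (x < midpoint n j)) => h; [left|right].
    exact/dyadic_left.
  exact/dyadic_right.
by move=> [/dyadic_left[]|/dyadic_right[]].
Qed.

Lemma lebesgue_measure_dyadic n j : mu (I n j) = (2 ^- n)%:E.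
Proof.
rewrite lebesgue_measure_itv /= lte_fin.
rewrite ltr_pM2r ?invr_gt0 ?exprn_gt0// ltr_nat ltnSn -EFinB -mulrBl.
by rewrite -[j.+1%:R]natr1 addrAC subrr add0r mul1r.
Qed.

Lemma stepfun_ind (P : R -> Prop) G T n j s x : admissible T ->
  (forall a b s, 0 < a -> 0 <= b -> P (G a b s)) -> P (stepfun G T n j s x).
Proof.
move=> + hG; elim: T n j s => [a b n j s [a0 b0]|l IHl r IHr n j s /= [hl hr]].
  exact: hG.
by case: ifP => _; [exact: IHl|exact: IHr].
Qed.

(** Induction on the tree, splitting the interval into halves, so that no change
    of variables is needed. *)
Lemma integral_stepfun G T n j s : admissible T ->
  (forall a b s, 0 < a -> 0 <= b -> 0 <= G a b s) ->
  (\int[mu]_(x in I n j) (stepfun G T n j s x)%:E = (2 ^- n * sqmean G s T)%:E)%E.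
Proof.
move=> + G0; elim: T n j s => [a b|l IHl r IHr] n j s hT.
  rewrite /= -[LHS]/(\int[mu]_(x in I n j) (cst (G a b s)%:E) x)%E.
  by rewrite integral_cst//= lebesgue_measure_dyadic -EFinM mulrC.
have [hl hr] := hT.
rewrite {1}dyadic_splitU ge0_integral_setU//=; last 3 first.
- apply/measurable_EFinP/(@measurable_funS _ _ _ _ setT) => //.
  exact: (measurable_stepfun G (Node l r)).
- by move=> x _; rewrite lee_fin; exact: (@stepfun_ind (fun v => 0 <= v) _ (Node l r)).
- apply/disj_setPS => x [/dyadic_left[_ h1] /dyadic_right[_]].
  by rewrite h1.
rewrite [X in (X + _)%E](_ : _ = \int[mu]_(x in I n.+1 j.*2)
    (stepfun G l n.+1 j.*2 (s + jump l r ^+ 2) x)%:E)%E; last first.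
  by apply: eq_integral => x /set_mem /dyadic_left[_ ->].
rewrite [X in (_ + X)%E](_ : _ = \int[mu]_(x in I n.+1 j.*2.+1)
    (stepfun G r n.+1 j.*2.+1 (s + jump l r ^+ 2) x)%:E)%E; last first.
  by apply: eq_integral => x /set_mem /dyadic_right[_ /negbTE ->].
rewrite IHl// IHr// -EFinD; congr EFin; rewrite exprS invfM; field.
by rewrite expf_neq0.
Qed.
End StepFunctions.

Section TreeFunctions.
Context {R : realType}.
Implicit Types (T : dtree R) (x y : R).
Local Notation mu := (@lebesgue_measure R).
Local Notation I n j := ([set` dyadic_itv R n j] : set R).

(** The midpoint of a dyadic interval is a grid point of all later generations,
    so a smaller dyadic interval through [x] follows the path of [x] in the
    tree. *)
Lemma integral_stepfun_node h k T n j s i x : admissible T ->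
  (forall a b, 0 < a -> 0 <= b -> 0 <= h a b) ->
  I n j x -> I (n + k) i x ->
  (\int[mu]_(y in I (n + k) i) (stepfun (fun a b _ => h a b) T n j s y)%:E =
   (2 ^- (n + k) * tmean h (node_at k T n j x))%:E)%E.
Proof.
move=> + h0; elim: k T n j s => [|k IH] T n j s hT xj xi.
  rewrite addn0 in xi *; rewrite (dyadic_uniq xi xj) integral_stepfun//.
    by rewrite sqmean_cst.
  by move=> *; exact: h0.
case: T hT => [a b hT|l r [hl hr]].
  exact: (@integral_stepfun _ (fun a b _ => h a b) _ (n + k.+1) i s hT
    (fun a b _ => h0 a b)).
rewrite -addSnnS in xi *.
have xlt y : I (n.+1 + k) i y -> (y < midpoint n j) = (x < midpoint n j).
  by move=> yi; rewrite (midpointE n j k) (dyadic_lt_grid _ yi) (dyadic_lt_grid _ xi).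
rewrite /=; have [xm|xm] := boolP (x < midpoint n j).
  rewrite -(IH l n.+1 j.*2 (s + jump l r ^+ 2) hl _ xi); last exact/dyadic_left.
  by apply: eq_integral => y /set_mem yi; rewrite xlt// xm.
rewrite -(IH r n.+1 j.*2.+1 (s + jump l r ^+ 2) hr _ xi); last exact/dyadic_right.
by apply: eq_integral => y /set_mem yi; rewrite xlt// (negbTE xm).
Qed.

Lemma A2_le_node A k T n j x : A2_le A T -> A2_le A (node_at k T n j x).
Proof.
elim: k T n j => //= k IH [a b|l r] n j // [_ [hl hr]].
by case: ifP => _; exact: IH.
Qed.

(** The series of the square function is finite at each point: it stops at the
    depth of the leaf. *)
Lemma sqpath_partial_sum T n j s x : exists N,
  stepfun (fun _ _ s => s) T n j s x = s + \sum_(0 <= k < N)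
    (fmean (node_at k.+1 T n j x) - fmean (node_at k T n j x)) ^+ 2.
Proof.
elim: T n j s => [a b|l IHl r IHr] n j s.
  by exists 0%N; rewrite big_geq// addr0.
have [xm|xm] := boolP (x < midpoint n j).
- have [N hN] := IHl n.+1 j.*2 (s + jump l r ^+ 2); exists N.+1.
  rewrite big_nat_recl//= xm hN -addrA; congr (_ + (_ + _)).
  by rewrite /jump /fmean /=; field.
- have [N hN] := IHr n.+1 j.*2.+1 (s + jump l r ^+ 2); exists N.+1.
  rewrite big_nat_recl//= (negbTE xm) hN -addrA; congr (_ + (_ + _)).
  by rewrite /jump /fmean /=; field.
Qed.

Definition tweight T : R -> R := stepfun (fun a _ _ => a) T 0 0 0.
Definition tfun T : R -> R := stepfun (fun _ b _ => b) T 0 0 0.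

Lemma unit_itvE : @unit_itv R = I 0 0.
Proof. by rewrite /unit_itv /dyadic_itv expr0 invr1 !mulr1. Qed.

Lemma exists_dyadic n x : unit_itv x -> exists2 j, (j < 2 ^ n)%N & I n j x.
Proof.
rewrite /unit_itv /= in_itv /= => /andP[x0 x1].
have n0 : 0 < 2 ^+ n :> R by rewrite exprn_gt0.
have xn0 : 0 <= x * 2 ^+ n by rewrite mulr_ge0// ltW.
exists (Num.truncn (x * 2 ^+ n)).
  by rewrite truncn_lt_nat// natrX -[ltRHS]mul1r ltr_pM2r.
by apply/in_dyadic; rewrite ler_pdivrMr// ltr_pdivlMr//; exact: truncn_itv.
Qed.

Lemma integral_tree h T n j x : admissible T ->
  (forall a b, 0 < a -> 0 <= b -> 0 <= h a b) -> I n j x -> unit_itv x ->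
  (\int[mu]_(y in I n j) (h (tweight T y) (tfun T y))%:E =
   (2 ^- n * tmean h (node_at n T 0 0 x))%:E)%E.
Proof.
move=> hT h0 xj; rewrite unit_itvE => x0.
have := @integral_stepfun_node h n T 0 0 0 j x hT h0 x0; rewrite add0n => /(_ xj) <-.
by apply: eq_integral => y _; rewrite [stepfun (fun a b _ => h a b) _ _ _ _ _]stepfun_comp.
Qed.

Lemma fine_lebesgue_dyadicV n j : (fine (mu (I n j)))^-1 = 2 ^+ n :> R.
Proof. by rewrite lebesgue_measure_dyadic /= invrK. Qed.

Lemma avg_tfun T n j x : admissible T -> I n j x -> unit_itv x ->
  avg (tfun T) (I n j) = fmean (node_at n T 0 0 x).
Proof.
move=> hT xj x0; rewrite /avg fine_lebesgue_dyadicV /Rintegral.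
by rewrite (@integral_tree (fun _ b => b) _ _ _ x)//= mulrA mulfV ?mul1r//.
Qed.

Lemma eavg_tree h T n j x : admissible T ->
  (forall a b, 0 < a -> 0 <= b -> 0 <= h a b) -> I n j x -> unit_itv x ->
  eavg (fun y => h (tweight T y) (tfun T y)) (I n j) =
  (tmean h (node_at n T 0 0 x))%:E.
Proof.
move=> hT h0 xj x0; rewrite /eavg fine_lebesgue_dyadicV (@integral_tree h _ _ _ x)//.
by rewrite -EFinM mulrA mulfV ?mul1r// expf_neq0.
Qed.

Lemma dyadic_avg_tfun T n x : admissible T -> unit_itv x ->
  dyadic_avg (tfun T) n x = fmean (node_at n T 0 0 x).
Proof.
move=> hT x0; have [j jn xj] := exists_dyadic n x0.
rewrite /dyadic_avg (bigD1 (Ordinal jn))//= big1 ?addr0.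
  by rewrite (avg_tfun hT xj x0) indicE mem_set// mul1r.
move=> i ij; rewrite indicE memNset ?mul0r// => xi.
by move/eqP: ij; apply; apply/val_inj/(dyadic_uniq xi xj).
Qed.

Lemma dyadic_left_end n j : (j < 2 ^ n)%N ->
  let x := j%:R * 2 ^- n : R in I n j x /\ unit_itv x.
Proof.
move=> jn /=; have n0 : 0 < 2 ^- n :> R by rewrite invr_gt0 exprn_gt0.
split; first by apply/in_dyadic; rewrite lexx/= ltr_pM2r// ltr_nat.
rewrite /unit_itv /= in_itv /= mulr_ge0 ?(ltW n0)//= ltr_pdivrMr ?exprn_gt0// mul1r.
by rewrite -natrX ltr_nat.
Qed.

Lemma A2char_tweight_le A T : admissible T -> A2_le A T -> (A2char (tweight T) <= A%:E)%E.
Proof.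
move=> hT hA; apply: ge_ereal_sup => _ [Q [n [j [jn ->]]] <-].
have [xj x0] := dyadic_left_end jn; set x := _ * _ in xj x0.
have -> := @eavg_tree (fun a _ => a) _ _ _ _ hT _ xj x0; last by move=> *; apply: ltW.
have -> := @eavg_tree (fun a _ => a^-1) _ _ _ _ hT _ xj x0; last first.
  by move=> a b a0 _; rewrite invr_ge0 ltW.
by rewrite -EFinM lee_fin; exact/A2_le_root/A2_le_node.
Qed.

Lemma A2char_tweight_ge T : admissible T ->
  ((wmean T * smean T)%:E <= A2char (tweight T))%E.
Proof.
move=> hT; apply: ereal_sup_ubound; exists (I 0 0); first by exists 0%N, 0%N.
have [xj x0] := @dyadic_left_end 0 0 isT; set x := _ * _ in xj x0.
have -> := @eavg_tree (fun a _ => a) _ _ _ _ hT _ xj x0; last by move=> *; apply: ltW.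
have -> := @eavg_tree (fun a _ => a^-1) _ _ _ _ hT _ xj x0; last first.
  by move=> a b a0 _; rewrite invr_ge0 ltW.
by [].
Qed.

Lemma tweight_gt0 T x : admissible T -> 0 < tweight T x.
Proof. by move=> hT; exact: (@stepfun_ind R (fun v => 0 < v)). Qed.

Lemma integral_unit_tree h T : admissible T ->
  (forall a b, 0 < a -> 0 <= b -> 0 <= h a b) ->
  (\int[mu]_(y in unit_itv) (h (tweight T y) (tfun T y))%:E = (tmean h T)%:E)%E.
Proof.
move=> hT h0; have [xj x0] := @dyadic_left_end 0 0 isT.
by rewrite unit_itvE (integral_tree hT h0 xj x0) expr0 invr1 mul1r.
Qed.

Lemma is_weight_tweight T : admissible T -> is_weight (tweight T).
Proof.
move=> hT; split; first by move=> x _; exact: tweight_gt0.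
apply/integrableP; split.
  apply/measurable_EFinP/(@measurable_funS _ _ _ _ setT) => //.
  exact: measurable_stepfun.
under eq_integral => x _ do rewrite /= ger0_norm ?(ltW (tweight_gt0 x hT))//.
rewrite (@integral_unit_tree (fun a _ => a))// ?ltry// => a b a0 _; exact: ltW.
Qed.

Lemma L2norm_tfun T : admissible T ->
  L2norm (tweight T) (tfun T) = (Num.sqrt (energy T))%:E.
Proof.
move=> hT; rewrite /L2norm.
under eq_integral => x _ do rewrite real_normK ?num_real//.
rewrite (@integral_unit_tree (fun a b => b ^+ 2 * a))// => a b a0 _.
by rewrite mulr_ge0 ?sqr_ge0 ?ltW.
Qed.

Definition sqpath T : R -> R := stepfun (fun _ _ s => s) T 0 0 0.

Lemma sqpath_le_square_fun T x : admissible T -> unit_itv x ->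
  ((Num.sqrt (sqpath T x))%:E <= square_fun (tfun T) x)%E.
Proof.
move=> hT x0; have [N hN] := sqpath_partial_sum T 0 0 0 x.
rewrite -[leLHS]/(sqrte (sqpath T x)%:E) /square_fun lee_sqrt; last first.
  rewrite adde_ge0 ?lee_fin ?sqr_ge0//.
  by apply: nneseries_ge0 => n _ _; rewrite lee_fin sqr_ge0.
rewrite /sqpath hN add0r.
set u := fun n => (`|dyadic_avg (tfun T) n.+1 x - dyadic_avg (tfun T) n x| ^+ 2)%:E.
apply: (@le_trans _ _ (\sum_(0 <= n < N) u n)%E).
  rewrite -sumEFin; apply: lee_sum => n _; rewrite /u !dyadic_avg_tfun//.
  by rewrite real_normK ?num_real.
apply: (@le_trans _ _ (\sum_(0 <= n <oo) u n)%E).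
  by apply: nneseries_lim_ge => n _ _; rewrite lee_fin sqr_ge0.
by rewrite leeDr// lee_fin sqr_ge0.
Qed.
End TreeFunctions.

(** * The weak norm and the theorem *)

Section WeakNorm.
Context {R : realType}.
Implicit Types (T : dtree R) (x y : R).
Local Notation mu := (@lebesgue_measure R).

(** Monotonicity of the integral of nonnegative functions straight from its
    definition as a supremum over simple functions; it applies to arbitrary
    sets, like the superlevel sets of the square function. *)
Lemma ge0_le_integral_patch (D E : set R) (f g : R -> \bar R) :
  (forall x, 0 <= f x)%E -> (forall x, 0 <= g x)%E ->
  (forall x, (f \_ D) x <= (g \_ E) x)%E ->
  (\int[mu]_(x in D) f x <= \int[mu]_(x in E) g x)%E.
Proof.
move=> f0 g0 fg; rewrite !ge0_integralE//.
by apply: ereal_sup_le => _ [h hf <-]; exists h => // x; exact: le_trans (hf x) (fg x).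
Qed.

Lemma weakL2norm_square_fun_ge T L : admissible T -> 0 < L ->
  ((Num.sqrt L * Num.sqrt (sqmean (fun a _ s => if L <= s then a else 0) 0 T))%:E <=
   weakL2norm (tweight T) (square_fun (tfun T)))%E.
Proof.
move=> hT L0; set m := sqmean _ _ _.
apply: (@le_trans _ _ ((Num.sqrt L)%:E * sqrte (weight_measure (tweight T)
    [set x | unit_itv x /\ ((Num.sqrt L)%:E <= `|square_fun (tfun T) x|)%E]))%E); last first.
  by apply: ereal_sup_ubound; exists (Num.sqrt L) => //=; rewrite sqrtr_gt0.
rewrite EFinM lee_pmul2l// ?lte_fin ?sqrtr_gt0// -[X in (X <= _)%E]/(sqrte m%:E).
have w0 x : (0 <= (tweight T x)%:E)%E by rewrite lee_fin ltW// tweight_gt0.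
rewrite lee_sqrt; last by apply: integral_ge0.
have G0 (a b s : R) : 0 < a -> 0 <= b -> 0 <= (if L <= s then a else 0).
  by move=> a0 _; case: ifP => // _; exact: ltW.
have := @integral_stepfun R (fun a _ s => if L <= s then a else 0) T 0 0 0 hT G0.
rewrite expr0 invr1 mul1r -/m => <-; rewrite -unit_itvE.
apply: ge0_le_integral_patch => // x.
  by rewrite lee_fin; exact: (@stepfun_ind R (fun v => 0 <= v)).
rewrite /patch; case: ifPn => [/set_mem x0|_]; last by case: ifPn.
rewrite stepfun_comp -/(tweight T x) -/(sqpath T x).
case: ifPn => [Ls|_]; last by case: ifPn.
rewrite mem_set//; split => //; apply: le_trans (lee_abs _).
apply: le_trans (sqpath_le_square_fun hT x0).
by rewrite lee_fin ler_wsqrtr.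
Qed.
End WeakNorm.

Theorem theorem1p2 (R : realType) (c : R) (hc : 1 <= c) :
  exists w : R -> R,
    in_A2d w /\ (c%:E <= A2char w)%E /\
    exists f : R -> R,
      in_L2 w f /\
      ((expR (- 2) / 48)%:E * sqrte (A2char w * lne (1 + A2char w))
         * L2norm w f < weakL2norm w (square_fun f))%E.
Proof.
(* The A_2 characteristic is at least N^6 / 2 with N > k >= 2 * c. *)
pose k := (Num.truncn (2 * c) + 12)%N; have k12 : (12 <= k)%N by exact: leq_addl.
have k2 : (2 <= k)%N by exact: leq_trans k12.
have kN := @ltn_exp2R R k.
set N := 2 ^+ k in kN.
have k12R : 12 <= k%:R :> R by rewrite ler_nat.
have ck : 2 * c <= k%:R.
  by apply/ltW/(lt_le_trans (truncnS_gt _)); rewrite ler_nat -addn1 leq_add2l.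
have N0 : 0 < N by lra.
pose T : dtree R := game k (4 ^ k) 1.
have H := @game_profile R k (4 ^ k) k2.
have hT : admissible T := profile_pos H ltr01.
have hA := A2char_tweight_le hT (profile_A2 H ltr01).
have hA' := A2char_tweight_ge hT.
have cA : (c%:E <= A2char (tweight T))%E.
  apply: le_trans hA'; rewrite (profile_w H ltr01) mul1r lee_fin.
  have : N ^+ 6 / 2 <= smean T by rewrite /T -(prednK (expn_gt0 4 k : 0 < _)%N) game_smean_ge.
  have : N <= N ^+ 6 by rewrite exprS ler_peMr ?(ltW N0)// exprn_ege1//; lra.
  lra.
exists (tweight T); split.
  by split; [exact: is_weight_tweight|exact: le_lt_trans hA (ltry _)].
split => //; exists (tfun T); split.
  split; last by rewrite L2norm_tfun// ltry.
  by apply: (@measurable_funS _ _ _ _ setT) => //; exact: measurable_stepfun.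
rewrite L2norm_tfun//.
pose L : R := k%:R * N ^+ 2 / 32.
have L0 : 0 < L by rewrite divr_gt0// mulr_gt0 ?exprn_gt0//; lra.
apply: lt_le_trans (weakL2norm_square_fun_ge hT L0).
have tail : 2^-1 <= sqmean (fun a _ s => if L <= s then a else 0) 0 T by exact: game_sqmean_ge.
have en : energy T <= 2 * N^-1 ^+ 6 * (4 ^ k)%:R by have := profile_e H ltr01; rewrite mulr1.
have cs := @constant_comparison R k N k12 erefl.
move: hA hA' cA; case: (A2char _) => [a| |]//; rewrite !lee_fin -/N => hA _ cA.
have a0 : 0 < 1 + a by lra.
rewrite lne_EFin// -EFinM /= lte_fin.
have l0 : 0 <= ln (1 + a) by rewrite ln_ge0//; lra.
have e0 := energy_ge0 hT.
have C0 : 0 <= expR (- 2) / 48 :> R by rewrite divr_ge0// expR_ge0.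
rewrite -[expR (- 2) / 48]ger0_norm// -sqrtr_sqr -!sqrtrM ?mulr_ge0 ?sqr_ge0//; try lra.
rewrite ltr_sqrt; last by apply: mulr_gt0 => //; lra.
apply: (@lt_le_trans _ _ (L * 2^-1)); last by rewrite ler_pM2l.
apply: le_lt_trans cs.
apply: ler_pM => //.
  by rewrite !mulr_ge0 ?sqr_ge0//; lra.
apply: ler_wpM2l; first by rewrite sqr_ge0.
apply: ler_pM => //; first lra.
by rewrite ler_ln ?posrE//; lra.
Qed.
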